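(* Let $\mathcal{I}$ be an inference system (over a set $\mathcal{S}$ of propositions) which is finite in conclusions and has a complement $\mathcal{J}$. Then, for every proposition $A \in \mathcal{S}$, either the sequent $\vdash A$ has a finite proof in the complementation $\mathcal{I}_{\mathcal{J}}$, or the sequent $\not\vdash A$ has a (possibly infinite) proof in $\mathcal{I}_{\mathcal{J}}$. Thus the system $\mathcal{I}_{\mathcal{J}}$ is complete.
   Context: Let $\mathcal{S}$ be a set whose elements are called propositions. An inference rule is a partial function $f$ from $\mathcal{S}^n$ to $\mathcal{S}$ for some natural number $n$ (its number of premises); a proposition $B$ is derivable from the sequence $\langle A_1,\dots,A_n\rangle$ with $f$ if $\langle A_1,\dots,A_n\rangle$ is in the domain of $f$ and $f(A_1,\dots,A_n)=B$. An inference system is a set of inference rules. It is finite in conclusions if for each proposition $B$ there are only finitely many sequences of propositions from which $B$ can be derived with a rule of the system. A (possibly infinite) proof in an inference system is a (possibly infinite) tree labeled with propositions such that whenever a node is labeled $B$ and its children are labeled $A_1,\dots,A_n$ (in order), $B$ is derivable from $\langle A_1,\dots,A_n\rangle$ with a rule of the system; it is a proof of $A$ if its root is labeled $A$, and a finite proof if the tree is finite. Complement: let $\mathcal{I}$ be finite in conclusions. An inference system $\mathcal{J}$ is a complement of $\mathcal{I}$ if $\mathcal{J}$ is finite in conclusions and, for each proposition $B$, if $\langle A^1_1,\dots,A^1_{n_1}\rangle,\dots,\langle A^p_1,\dots,A^p_{n_p}\rangle$ are all the sequences from which $B$ is derivable with a rule of $\mathcal{I}$, then the sequences from which $B$ is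 derivable with a rule of $\mathcal{J}$ are exactly the sequences $\langle A^1_{j_1},\dots,A^p_{j_p}\rangle$ with $1\le j_i\le n_i$ for each $i$. Complementation: let $\mathcal{S}'$ be the set of sequents $\vdash A$ and $\not\vdash A$ for $A\in\mathcal{S}$. The inference system $\mathcal{I}_{\mathcal{J}}$ on $\mathcal{S}'$ consists of, for each rule $f$ of $\mathcal{I}$, the rule mapping $\vdash A_1,\dots,\vdash A_n$ to $\vdash f(A_1,\dots,A_n)$, and for each rule $f$ of $\mathcal{J}$, the rule mapping $\not\vdash A_1,\dots,\not\vdash A_n$ to $\not\vdash f(A_1,\dots,A_n)$ (on the same domains). *)

(* Defs.v *)
From mathcomp Require Import all_boot.
From mathcomp Require Import boolp classical_sets cardinality.

Set Implicit Arguments.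
Unset Strict Implicit.
Unset Printing Implicit Defensive.

Local Open Scope classical_set_scope.

(* A partial function is given by its functional graph, so that its domain
   need not be decidable. *)
Record rule (S : Type) : Type := Rule {
  arity : nat;
  graph : arity.-tuple S -> S -> Prop;
  graph_functional :
    forall t A B, graph t A -> graph t B -> A = B }.

Definition inference_system (S : Type) : Type := set (rule S).

Definition derivable_with (S : Type) (f : rule S) (s : seq S) (B : S) : Prop :=
  exists2 t : (arity f).-tuple S, tval t = s & graph t B.

Definition derivable (S : Type) (K : inference_system S) (s : seq S) (B : S) :
    Prop :=
  exists2 f, K f & derivable_with f s B.

Definition finite_in_conclusions (S : Type) (K : inference_system S) : Prop :=
  forall B, finite_set [set s | derivable K s B].

(* A node is the list of child indices (numbered from 0) on the path leading
   to it from the root; [label p = None] means that [p] is not a node.  The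
   children of every node form a finite sequence, since the rules have finitely
   many premises. *)
Record tree (S : Type) : Type := Tree {
  label : seq nat -> option S;
  label_root : label [::] <> None;
  label_parent : forall p i, label p = None -> label (rcons p i) = None;
  label_children :
    forall p, exists s : seq S, forall i, label (rcons p i) = onth s i }.

Definition children (S : Type) (t : tree S) (p : seq nat) (s : seq S) : Prop :=
  forall i, label t (rcons p i) = onth s i.

Definition finite_tree (S : Type) (t : tree S) : Prop :=
  finite_set [set p | label t p <> None].

Definition is_proof (S : Type) (K : inference_system S) (t : tree S) : Prop :=
  forall p B s, label t p = Some B -> children t p s -> derivable K s B.

Definition proof_of (S : Type) (K : inference_system S) (A : S) (t : tree S) :
    Prop :=
  is_proof K t /\ label t [::] = Some A.

Definition has_proof (S : Type) (K : inference_system S) (A : S) : Prop :=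
  exists t, proof_of K A t.

Definition has_finite_proof (S : Type) (K : inference_system S) (A : S) : Prop :=
  exists2 t, proof_of K A t & finite_tree t.

(* The order of the premises in the rules of [J] depends on the order in which
   the premise sequences of [B] in [I] are listed.  A complement fixes, for each
   [B], one such listing [A] without repetition. *)
Definition complement (S : Type) (I J : inference_system S) : Prop :=
  finite_in_conclusions J /\
  forall B : S, exists (p : nat) (A : 'I_p -> seq S),
    [/\ injective A,
        forall s, derivable I s B <-> exists i, s = A i
      & forall s, derivable J s B <->
          exists j : forall i : 'I_p, 'I_(size (A i)),
            s = [seq tnth (in_tuple (A i)) (j i) | i <- enum 'I_p]].

Inductive sequent (S : Type) : Type :=
| vdash of S
| nvdash of S.

Lemma vdash_inj (S : Type) : injective (@vdash S).
Proof. by move=> A B []. Qed.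

Lemma nvdash_inj (S : Type) : injective (@nvdash S).
Proof. by move=> A B []. Qed.

Definition lift_graph (S T : Type) (c : S -> T) (f : rule S)
    (u : (arity f).-tuple T) (C : T) : Prop :=
  exists t B, [/\ u = map_tuple c t, C = c B & graph t B].

Lemma lift_graph_functional (S T : Type) (c : S -> T) (cI : injective c)
    (f : rule S) (u : (arity f).-tuple T) (A B : T) :
  lift_graph c u A -> lift_graph c u B -> A = B.
Proof.
move=> [t [A' [-> -> fA]]] [t' [B' [tt' -> fB]]].
have tE : t = t' by apply/val_inj/(inj_map cI)/(congr1 val tt').
by rewrite -tE in fB; rewrite (graph_functional fA fB).
Qed.

Definition lift_rule (S T : Type) (c : S -> T) (cI : injective c) (f : rule S) :
    rule T :=
  Rule (@lift_graph_functional S T c cI f).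

Definition complementation (S : Type) (I J : inference_system S) :
    inference_system (sequent S) :=
  (lift_rule (@vdash_inj S) @` I) `|` (lift_rule (@nvdash_inj S) @` J).

Definition complete (S : Type) (K : inference_system (sequent S)) : Prop :=
  forall A : S, has_proof K (vdash A) \/ has_proof K (nvdash A).

(* Main.v *)
(** If some premise sequence of [B] consists of finitely provable
    propositions only, grafting their proofs shows that [B] is finitely provable.
    Hence, if [B] has no finite proof in [I], each premise sequence of [B]
    contains a proposition without finite proof; selecting one in each gives a
    rule of the complement that derives [B] from propositions without finite
    proofs.  Iterating this choice unfolds a proof of [nvdash B], infinite in
    general. *)
Require Import Defs.
From mathcomp Require Import all_boot.
From mathcomp Require Import boolp classical_sets cardinality.

Set Implicit Arguments.
Unset Strict Implicit.
Unset Printing Implicit Defensive.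

Local Open Scope classical_set_scope.

(** [is_proof] quantifies over every [s] listing the children; uniqueness lets that [s] be replaced
    by the list known from the construction. *)
Lemma children_inj (T : Type) (t : tree T) p s1 s2 :
  children t p s1 -> children t p s2 -> s1 = s2.
Proof. by move=> h1 h2; apply: eq_from_onth => i; rewrite -h1 -h2. Qed.

Section Graft.
Context {T : Type}.
Implicit Types (B C : T) (t : tree T) (ts : seq (tree T)) (p : seq nat).

Lemma tree_root_ex t : exists B, label t [::] = Some B.
Proof. by case: (label t [::]) (@label_root _ t) => [B|] // _; exists B. Qed.

Definition tree_root t : T := sval (cid (tree_root_ex t)).

Lemma tree_rootE t : label t [::] = Some (tree_root t).
Proof. exact: svalP (cid (tree_root_ex t)). Qed.

Definition graft_label B ts p : option T :=
  if p is i :: q then obind (fun t => label t q) (onth ts i) else Some B.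

Lemma graft_label_root B ts : graft_label B ts [::] <> None.
Proof. by []. Qed.

Lemma graft_label_parent B ts p i :
  graft_label B ts p = None -> graft_label B ts (rcons p i) = None.
Proof.
by case: p => //= j q; case: (onth ts j) => //= t; exact: label_parent.
Qed.

Lemma graft_children_root B ts i :
  graft_label B ts [:: i] = onth (map tree_root ts) i.
Proof. by rewrite /= onth_map; case: onth => //= t; rewrite tree_rootE. Qed.

Lemma graft_label_children B ts p :
  exists s, forall i, graft_label B ts (rcons p i) = onth s i.
Proof.
case: p => [|j q] /=.
  by exists (map tree_root ts) => i; exact: (graft_children_root B).
case: (onth ts j) => /= [t|]; first exact: label_children.
by exists [::] => i; rewrite onth0n.
Qed.

Definition graft B ts : tree T :=
  Tree (graft_label_root (ts := ts)) (@graft_label_parent B ts)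
       (graft_label_children B ts).

(** Apart from the root, the nodes form a finite union, over the positions in [ts], of copies of
    finite node sets. *)
Lemma graft_finite B ts :
  (forall i t, onth ts i = Some t -> finite_tree t) ->
  finite_tree (graft B ts).
Proof.
move=> fin_ts.
pose sub i := [set p | obind (fun t => label t p) (onth ts i) <> None].
apply: (@sub_finite_set _ _
  ([set [::]] `|` \bigcup_(i in `I_(size ts)) (cons i @` sub i))).
  move=> [|i p] /= hp; [by left | right].
  exists i; last by exists p.
  by rewrite /= -onthTE; case: onth hp.
rewrite finite_setU; split; first exact: finite_set1.
apply: bigcup_finite => [|i _]; first exact: finite_II.
apply: finite_image; rewrite /sub.
case e: (onth ts i) => [t|] /=; first exact: fin_ts e.
(* The bound on [i] was dropped, so indices out of range remain; they contribute no node. *)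
by apply: (@sub_finite_set _ _ set0) => // p /=.
Qed.

Lemma graft_proof (K : inference_system T) B ts :
  derivable K (map tree_root ts) B ->
  (forall i t, onth ts i = Some t -> is_proof K t) ->
  proof_of K B (graft B ts).
Proof.
move=> KB pr_ts; split=> // -[|i q] C s /=.
  case=> <- hs; rewrite (children_inj hs (s2 := map tree_root ts)) // => i.
  exact: graft_children_root.
(* Below the root, a node and its children lie in the same grafted tree, which is itself a proof. *)
move=> + hs; rewrite /children /= in hs.
case e: (onth ts i) hs => [t|] //= hs hC.
exact: pr_ts e _ _ _ hC hs.
Qed.

(** Proofs of the premises are gathered into a list by induction on [s], then grafted under a root
    labelled [B]. *)
Lemma has_finite_proof_step (K : inference_system T) s B :
  derivable K s B ->
  (forall i C, onth s i = Some C -> has_finite_proof K C) ->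
  has_finite_proof K B.
Proof.
move=> KB fin_s.
have [ts tsE pr_ts] : exists2 ts, map tree_root ts = s &
    forall i t, onth ts i = Some t -> is_proof K t /\ finite_tree t.
  elim: s fin_s {KB} => [|C s IH] fin_s.
    by exists [::] => // i t; rewrite onth0n.
  have [t [tK tC] tfin] := fin_s 0 C erefl.
  have [ts <- pr_ts] := IH (fun i => fin_s i.+1).
  exists (t :: ts) => /=.
    by congr cons; move: tC; rewrite tree_rootE => -[].
  by case=> [|i] u /=; [case=> <- | exact: pr_ts].
rewrite -tsE in KB.
exists (graft B ts).
  by apply: graft_proof => // i t /pr_ts[].
by apply: graft_finite => i t /pr_ts[].
Qed.

End Graft.

Section Unfold.
Context {T : Type}.
Variables (next : T -> seq T) (A : T).

(** Each path is finite, so a possibly infinite tree is obtained by plain recursion along paths,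
    without coinductive types. *)
Definition unfold_label (p : seq nat) : option T :=
  foldl (fun o i => obind (fun B => onth (next B) i) o) (Some A) p.

Lemma unfold_label_rcons p i :
  unfold_label (rcons p i) =
  obind (fun B => onth (next B) i) (unfold_label p).
Proof. by rewrite /unfold_label foldl_rcons. Qed.

Lemma unfold_label_root : unfold_label [::] <> None.
Proof. by []. Qed.

Lemma unfold_label_parent p i :
  unfold_label p = None -> unfold_label (rcons p i) = None.
Proof. by rewrite unfold_label_rcons => ->. Qed.

Lemma unfold_label_children p :
  exists s, forall i, unfold_label (rcons p i) = onth s i.
Proof.
exists (oapp next [::] (unfold_label p)) => i; rewrite unfold_label_rcons.
by case: unfold_label => //=; rewrite onth0n.
Qed.

Definition unfold_tree : tree T :=
  Tree unfold_label_root unfold_label_parent unfold_label_children.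

End Unfold.

(** Coinduction principle: premise sequences staying inside [Q] are chosen once for all propositions
    and unfolded from [A]. *)
Lemma has_proof_coind (T : Type) (K : inference_system T) (Q : T -> Prop) :
  (forall B, Q B -> exists2 s, derivable K s B &
     forall i C, onth s i = Some C -> Q C) ->
  forall A, Q A -> has_proof K A.
Proof.
move=> step A QA.
(* With [Q B] under the existential, [next] is total; its value [[::]] outside [Q] is never reached
   from [A]. *)
have /choice[next nextP] : forall B, exists s, Q B ->
    derivable K s B /\ forall i C, onth s i = Some C -> Q C.
  move=> B; have [/step[s sB sQ]|nQ] := pselect (Q B); first by exists s.
  by exists [::].
exists (unfold_tree next A); split=> // p B s pB hs.
(* Invariant of the unfolding: every label satisfies [Q], by induction on the depth of the node. *)
have QB : Q B.
  elim/last_ind: p B pB {s hs} => [|p i IH] B /=; first by case=> <-.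
  rewrite unfold_label_rcons; case e: unfold_label => [C|] //=.
  exact: (nextP C (IH C e)).2.
rewrite (children_inj hs (s2 := next B)); first exact: (nextP B QB).1.
move: pB => /= pB i; by rewrite /= unfold_label_rcons pB.
Qed.

Lemma derivable_lift (S T : Type) (c : S -> T) (cI : injective c)
    (K : inference_system S) s B :
  derivable K s B -> derivable (lift_rule cI @` K) (map c s) (c B).
Proof.
move=> [f Kf [t <- fB]]; exists (lift_rule cI f); first by exists f.
by exists (map_tuple c t) => //; exists t, B.
Qed.

Lemma derivable_vdash (S : Type) (I J : inference_system S) s B :
  derivable I s B ->
  derivable (complementation I J) (map (@vdash S) s) (vdash B).
Proof.
by move=> /(derivable_lift (@vdash_inj S))[f If fB]; exists f; [left|].
Qed.

Lemma derivable_nvdash (S : Type) (I J : inference_system S) s B :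
  derivable J s B ->
  derivable (complementation I J) (map (@nvdash S) s) (nvdash B).
Proof.
by move=> /(derivable_lift (@nvdash_inj S))[f Jf fB]; exists f; [right|].
Qed.

(** One position outside [P] in each listed sequence [A i] is exactly a selection [j] as in the
    definition of a complement. *)
Lemma complement_escape (S : Type) (I J : inference_system S) (P : S -> Prop)
    (B : S) :
  complement I J ->
  (forall s, derivable I s B -> exists i C, onth s i = Some C /\ ~ P C) ->
  exists2 s, derivable J s B & forall i C, onth s i = Some C -> ~ P C.
Proof.
move=> [_ /(_ B)[p [A [_ IB JB]]]] esc.
have pick i : {j : 'I_(size (A i)) | ~ P (tnth (in_tuple (A i)) j)}.
  apply: cid.
  have /esc[k [C [kC nPC]]] : derivable I (A i) B by apply/IB; exists i.
  have lt_k : k < size (A i) by rewrite -onthTE kC.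
  by exists (Ordinal lt_k); rewrite (tnth_onth C _ _).2.
exists [seq tnth (in_tuple (A i)) (sval (pick i)) | i <- enum 'I_p].
  by apply/JB; exists (fun i => sval (pick i)).
move=> k C; rewrite onth_map; case: onth => //= i [<-]; exact: svalP (pick i).
Qed.

Theorem theorem1 (S : Type) (I J : inference_system S)
    (hI : finite_in_conclusions I) (hJ : complement I J) :
  (forall A : S,
     has_finite_proof (complementation I J) (vdash A) \/
     has_proof (complementation I J) (nvdash A)) /\
  complete (complementation I J).
Proof.
set K := complementation I J.
have dich A : has_finite_proof K (vdash A) \/ has_proof K (nvdash A).
  have [|nA] := pselect (has_finite_proof K (vdash A)); [by left | right].
  (* Finite provability is taken in [K] itself, so no proof has to be transferred between [I] and
     [K]. *)
  pose Q C := exists2 B, C = nvdash B & ~ has_finite_proof K (vdash B).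
  apply: (@has_proof_coind _ K Q); last by exists A.
  move=> _ [B -> nB].
  have [s IB|s JB sP] :=
      @complement_escape S I J (fun C => has_finite_proof K (vdash C)) B hJ.
    (* If every member of [s] were finitely provable, the lifted rule of [I] would prove [vdash B]
       finitely. *)
    apply: contrapT => all_s; apply: nB.
    apply: (has_finite_proof_step (derivable_vdash J IB)) => i C'.
    rewrite onth_map; case e: onth => [C|] //= [<-].
    by apply: contrapT => nC; apply: all_s; exists i, C.
  exists (map (@nvdash S) s); first exact: derivable_nvdash.
  move=> i C; rewrite onth_map; case e: onth => [D|] //= [<-].
  by exists D => //; exact: sP e.
split=> // A; have [[t tA _]|] := dich A; last by right.
by left; exists t.
Qed.
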